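(* Let $\ell,m,n\ge 1$. The order of rowmotion $\mathrm{row}$ as a permutation of $J([\ell]\times[m]\times[n])$ is divisible by $m+n+\ell-1$.
   Context: $[a]$ is the $a$-element chain, $[\ell]\times[m]\times[n]$ the product poset with componentwise order, and $J(P)$ the set of order ideals of $P$. Rowmotion: $\mathrm{row}(I)$ is the order ideal generated by the minimal elements of $P\setminus I$. *)

(* Defs.v *)
From HB Require Import structures.
From mathcomp Require Import all_boot all_order all_fingroup.

Set Implicit Arguments.
Unset Strict Implicit.
Unset Printing Implicit Defensive.

Import Order.TTheory.

Section Ideals.

Context {d : Order.disp_t} {P : finPOrderType d}.
Implicit Types (A I : {set P}) (x y : P).

Definition is_order_ideal I : bool :=
  [forall x, forall y in I, (x <= y)%O ==> (x \in I)].

Definition minimal_elements A : {set P} :=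
  [set x in A | [forall y in A, (y <= x)%O ==> (y == x)]].

Definition generated_ideal A : {set P} :=
  [set x | [exists y in A, (x <= y)%O]].

Lemma is_order_idealP I :
  reflect (forall x y, y \in I -> (x <= y)%O -> x \in I) (is_order_ideal I).
Proof.
apply: (iffP forallP) => [idI x y Iy lexy|idI x].
  by have /forall_inP/(_ y Iy)/implyP := idI x; apply.
by apply/forall_inP => y Iy; apply/implyP; apply: idI Iy.
Qed.

Lemma minimal_elementsP A x :
  reflect (x \in A /\ forall y, y \in A -> (y <= x)%O -> y = x)
          (x \in minimal_elements A).
Proof.
rewrite inE; apply: (iffP andP) => -[Ax minx]; split=> //.
  by move=> y Ay leyx; have /implyP/(_ leyx)/eqP := forall_inP minx y Ay.
by apply/forall_inP => y Ay; apply/implyP => leyx; apply/eqP/minx.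
Qed.

Lemma generated_idealP A x :
  reflect (exists2 y, y \in A & (x <= y)%O) (x \in generated_ideal A).
Proof. by rewrite inE; apply: (iffP exists_inP). Qed.

Lemma generated_ideal_is_order_ideal A : is_order_ideal (generated_ideal A).
Proof.
apply/is_order_idealP => x y /generated_idealP[z Az leyz] lexy.
by apply/generated_idealP; exists z => //; apply: le_trans leyz.
Qed.

Lemma minimal_elements_below A x :
  x \in A -> exists2 y, y \in minimal_elements A & (y <= x)%O.
Proof.
move=> Ax; pose Q y := (y \in A) && (y <= x)%O.
have Qx : Q x by rewrite /Q Ax lexx.
pose F y := #|[set z : P | (z <= y)%O]|.
case: (arg_minnP F Qx) => y /andP[Ay leyx] miny.
exists y => //; apply/minimal_elementsP; split=> // z Az lezy.
have /miny : Q z by rewrite /Q Az (le_trans lezy leyx).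
rewrite /F leqNgt => /negP H; apply/eqP/negPn/negP => nzy; apply: H.
apply: proper_card; apply/properP; split.
  by apply/subsetP => w; rewrite !inE => /le_trans; apply.
exists y; rewrite inE ?lexx //; apply: contra nzy => leyz.
by rewrite eq_le lezy.
Qed.

End Ideals.

Record order_ideal {d : Order.disp_t} (P : finPOrderType d) := OrderIdeal {
  ideal_set :> {set P};
  ideal_setP : is_order_ideal ideal_set
}.

HB.instance Definition _ d (P : finPOrderType d) :=
  [isSub for @ideal_set d P].
HB.instance Definition _ d (P : finPOrderType d) :=
  [Countable of order_ideal P by <:].
HB.instance Definition _ d (P : finPOrderType d) :=
  [Finite of order_ideal P by <:].

Section Rowmotion.

Context {d : Order.disp_t} {P : finPOrderType d}.

Definition rowmotion (I : order_ideal P) : order_ideal P :=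
  OrderIdeal (generated_ideal_is_order_ideal (minimal_elements (~: I))).

Lemma rowmotion_inj : injective rowmotion.
Proof.
have min_sub (I J : order_ideal P) : rowmotion I = rowmotion J ->
    minimal_elements (~: I) \subset minimal_elements (~: J).
  move=> /(congr1 (@ideal_set d P)) /= /setP eqIJ; apply/subsetP => x minx.
  have : x \in generated_ideal (minimal_elements (~: I)).
    by apply/generated_idealP; exists x.
  rewrite eqIJ => /generated_idealP[y miny lexy].
  have : y \in generated_ideal (minimal_elements (~: J)).
    by apply/generated_idealP; exists y.
  rewrite -eqIJ => /generated_idealP[z minz leyz].
  have /minimal_elementsP[Ix _] := minx.
  have /minimal_elementsP[_ /(_ x Ix (le_trans lexy leyz)) eqxz] := minz.
  suff -> : x = y by [].
  by apply/eqP; rewrite eq_le lexy eqxz.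
have comp_sub (I J : order_ideal P) : rowmotion I = rowmotion J ->
    ~: I \subset ~: J.
  move=> /min_sub/subsetP sIJ; apply/subsetP => x.
  move=> /minimal_elements_below[y /sIJ/minimal_elementsP[]].
  rewrite !inE => nJy _ leyx; apply: contra nJy => Jx.
  exact: (is_order_idealP _ (ideal_setP J)) Jx leyx.
move=> I J eqIJ; apply/val_inj/setC_inj/eqP.
by rewrite eqEsubset !comp_sub.
Qed.

Definition rowmotion_perm : {perm order_ideal P} := perm rowmotion_inj.

End Rowmotion.

(* The library orders 'I_a as a chain, and *p is the product with the
   componentwise order. *)
Notation chain_product l m n := ('I_l *p 'I_m *p 'I_n)%type.

(* Main.v *)
Require Import Defs.
From HB Require Import structures.
From mathcomp Require Import all_boot all_order all_fingroup.
From mathcomp Require Import zify.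

(** In a graded poset with [h] ranks, rowmotion sends the ideal of elements of
    rank [< k] to the ideal of elements of rank [< k + 1] for [k < h], and the
    whole poset to the empty ideal.  The orbit of the empty ideal therefore has
    exactly [h + 1] elements, and [h = l + m + n - 2] for a product of three
    chains. *)

Set Implicit Arguments.
Unset Strict Implicit.
Unset Printing Implicit Defensive.

Import Order.TTheory.

Section GradedRowmotion.

Context {d : Order.disp_t} {P : finPOrderType d}.
Variables (rk : P -> nat) (h : nat).
Hypothesis rk_mono : forall x y, (x < y)%O -> rk x < rk y.
Hypothesis rk_bound : forall x, rk x < h.
Hypothesis rk_up :
  forall x, (rk x).+1 < h -> exists2 y, (x <= y)%O & rk y = (rk x).+1.
Hypothesis rk_down :
  forall x, 0 < rk x -> exists2 y, (y <= x)%O & rk x = (rk y).+1.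
Variable x0 : P.
Hypothesis rk_x0 : rk x0 = 0.

Let rk_le x y : (x <= y)%O -> rk x <= rk y.
Proof. by rewrite le_eqVlt => /predU1P[->|/rk_mono/ltnW]. Qed.

Lemma rank_ideal_subproof k : is_order_ideal [set x | rk x < k].
Proof.
by apply/is_order_idealP => x y; rewrite !inE => lt_yk /rk_le/leq_ltn_trans; apply.
Qed.

Definition rank_ideal k : order_ideal P := OrderIdeal (rank_ideal_subproof k).

(** An element of rank above [k] dominates, by [rk_down], one of rank one less that still lies in
    the complement, so it is not minimal. For [k >= h] both sides are empty. *)
Lemma minimal_elements_rank_ideal k :
  minimal_elements (~: rank_ideal k) = [set x | rk x == k].
Proof.
apply/setP => x; apply/minimal_elementsP/idP; rewrite !inE -leqNgt.
  case=> le_kx minx; rewrite eqn_leq le_kx andbT leqNgt; apply/negP => lt_kx.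
  have [y le_yx rkx] := rk_down (leq_ltn_trans (leq0n k) lt_kx).
  have yx : y = x by apply: minx le_yx; rewrite !inE -leqNgt -ltnS -rkx.
  by move/eqP: rkx; rewrite yx -[_ == _]negbK neq_ltn ltnSn.
move/eqP=> rkx; split=> [|y]; first by rewrite rkx.
rewrite !inE -leqNgt le_eqVlt -rkx => le_xy /predU1P[//|/rk_mono].
by rewrite ltnNge le_xy.
Qed.

Lemma exists_rank_above k x :
  rk x <= k -> k < h -> exists2 y, (x <= y)%O & rk y = k.
Proof.
(* Induction on a bound for the rank gap [k - rk x]; each use of [rk_up] closes it by one. *)
move=> le_xk lt_kh; have [e] := ubnP (k - rk x).
elim: e x le_xk => // e IHe x; rewrite leq_eqVlt => /predU1P[rkx|lt_xk] lt_e.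
  by exists x.
have [y le_xy rky] := rk_up (leq_ltn_trans lt_xk lt_kh).
have [||z le_yz rkz] := IHe y; [by rewrite rky | by lia |].
by exists z => //; apply: le_trans le_yz.
Qed.

Lemma rowmotion_rank_ideal k :
  k < h -> rowmotion (rank_ideal k) = rank_ideal k.+1.
Proof.
move=> lt_kh; apply/val_inj/setP => x /=; rewrite minimal_elements_rank_ideal.
apply/generated_idealP/idP; rewrite inE ltnS.
  by case=> y; rewrite inE => /eqP <- /rk_le.
by case/exists_rank_above=> // y le_xy rky; exists y; rewrite ?inE ?rky.
Qed.

(** No element has rank [h], so the complement has no minimal elements and generates the empty
    ideal. *)
Lemma rowmotion_rank_ideal_top : rowmotion (rank_ideal h) = rank_ideal 0.
Proof.
apply/val_inj/setP => x /=; rewrite minimal_elements_rank_ideal.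
apply/generated_idealP/idP; rewrite inE // => -[y]; rewrite inE => /eqP rky.
by have := rk_bound y; rewrite rky ltnn.
Qed.

Lemma iter_rowmotion_rank_ideal k :
  iter k rowmotion (rank_ideal 0) = rank_ideal (k %% h.+1).
Proof.
elim: k => [|k IHk]; first by rewrite mod0n.
rewrite iterS IHk.
have: k %% h.+1 <= h by rewrite -ltnS ltn_pmod.
(* Either the residue is [h] and wraps around to the empty ideal, or it grows by one. *)
rewrite -[k.+1]addn1 -modnDml leq_eqVlt => /predU1P[->|lt_kh].
  by rewrite addn1 modnn rowmotion_rank_ideal_top.
by rewrite rowmotion_rank_ideal // addn1 (modn_small (m := _.+1)).
Qed.

(** If [N] is the order, the [N]-th power fixes the empty ideal, so [rank_ideal (N %% h.+1)] is
    empty. As [x0] has rank 0, it would belong to this ideal if the residue were positive. *)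
Lemma dvdn_order_rowmotion : h.+1 %| #[@rowmotion_perm d P]%g.
Proof.
have := permX rowmotion_perm (rank_ideal 0) #[@rowmotion_perm d P]%g.
rewrite expg_order perm1 (eq_iter (permE rowmotion_inj)).
rewrite iter_rowmotion_rank_ideal => /(congr1 (@ideal_set d P))/setP/(_ x0).
by rewrite !inE rk_x0 ltnn /dvdn lt0n => /esym/negbFE.
Qed.

End GradedRowmotion.

(** Coordinates start at 0, so the ranks run from 0 to [l + m + n - 3]. *)
Definition chain_rank l m n (x : chain_product l m n) : nat :=
  x.1.1 + x.1.2 + x.2.

Lemma le_chain_product l m n (x y : chain_product l m n) :
  (x <= y)%O = [&& (x.1.1 <= y.1.1)%N, (x.1.2 <= y.1.2)%N & (x.2 <= y.2)%N].
Proof. by rewrite !leEprod /= -andbA. Qed.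

Lemma chain_rank_mono l m n (x y : chain_product l m n) :
  (x < y)%O -> chain_rank x < chain_rank y.
Proof.
rewrite lt_neqAle le_chain_product /chain_rank => /andP[ne_xy /and3P[le1 le2 le3]].
(* Componentwise inequalities whose sums satisfy the reverse inequality are all equalities. *)
rewrite ltnNge; apply: contra ne_xy => le_yx.
case: x y le1 le2 le3 le_yx => [[x1 x2] x3] [[y1 y2] y3] /= le1 le2 le3 le_yx.
have [e1 e2 e3] : [/\ x1 = y1, x2 = y2 & x3 = y3].
  by split; apply: val_inj => /=; lia.
by rewrite e1 e2 e3.
Qed.

Lemma chain_rank_up l m n (x : chain_product l m n) :
  (chain_rank x).+1 < l + m + n - 2 ->
  exists2 y, (x <= y)%O & chain_rank y = (chain_rank x).+1.
Proof.
case: x => [[a b] c]; rewrite /chain_rank /= => lt_h.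
have [lt_l|ge_l] := ltnP a.+1 l.
  exists (Ordinal lt_l, b, c); last by rewrite /=; lia.
  by rewrite le_chain_product /= leqnSn !leqnn.
have [lt_m|ge_m] := ltnP b.+1 m.
  exists (a, Ordinal lt_m, c); last by rewrite /=; lia.
  by rewrite le_chain_product /= leqnSn !leqnn.
(* The first two coordinates are maximal here, so the rank bound leaves room in the third. *)
have lt_n : c.+1 < n by lia.
exists (a, b, Ordinal lt_n); last by rewrite /=; lia.
by rewrite le_chain_product /= leqnSn !leqnn.
Qed.

Lemma chain_rank_down l m n (x : chain_product l m n) :
  0 < chain_rank x ->
  exists2 y, (y <= x)%O & chain_rank x = (chain_rank y).+1.
Proof.
case: x => [[a b] c]; rewrite /chain_rank /= => gt0.
(* Truncated predecessors stay in range even at 0; below, only a positive coordinate is lowered. *)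
have [lt_l lt_m lt_n] : [/\ a.-1 < l, b.-1 < m & c.-1 < n].
  by split; apply: leq_ltn_trans (leq_pred _) (ltn_ord _).
have [a0|a_gt0] := posnP a; last first.
  exists (Ordinal lt_l, b, c); last by rewrite /=; lia.
  by rewrite le_chain_product /= leq_pred !leqnn.
have [b0|b_gt0] := posnP b; last first.
  exists (a, Ordinal lt_m, c); last by rewrite /=; lia.
  by rewrite le_chain_product /= leq_pred !leqnn.
(* With [a] and [b] zero, [gt0] makes [c] positive. *)
exists (a, b, Ordinal lt_n); last by rewrite /=; lia.
by rewrite le_chain_product /= leq_pred !leqnn.
Qed.

Theorem theorem7p4 (l m n : nat) (hl : 1 <= l) (hm : 1 <= m) (hn : 1 <= n) :
  m + n + l - 1 %| #[@rowmotion_perm _ (chain_product l m n)]%g.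
Proof.
(* The truncated subtractions are exact since [l], [m] and [n] are positive; positivity also
   supplies the bottom element used as [x0]. *)
have -> : m + n + l - 1 = (l + m + n - 2).+1 by lia.
apply: (dvdn_order_rowmotion (@chain_rank_mono l m n) _ (@chain_rank_up l m n)
  (@chain_rank_down l m n) (x0 := (Ordinal hl, Ordinal hm, Ordinal hn))) => //.
case=> [[a b] c]; rewrite /chain_rank /=.
by have := ltn_ord a; have := ltn_ord b; have := ltn_ord c; lia.
Qed.
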